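(* Let $n\ge 2$. There exist scalars $\lambda_1,\lambda_2\in\mathbb{C}$ such that $$\mathcal{F}=\left[\lambda_1\mathcal{I}_1\oplus\lambda_2\mathcal{I}_{n-1}\right]\mathcal{T},$$ where $\mathcal{F}$ is the $n\times n$ matrix of the Fourier transform on $I_n=\{1,\ldots,n\}$ (viewed as the homogeneous space $S_n/S_n^n$) and $\mathcal{T}=AU$ is the orthogonal matrix defined in the context.
   Context: $S_n$ is the symmetric group on $I_n=\{1,\ldots,n\}$, with product given by composition, $(\sigma\delta)(i)=\sigma(\delta(i))$; $S_n^n$ is the subgroup fixing $n$. $\mathcal{I}_m$ denotes the $m\times m$ identity matrix, ${}^t$ denotes transpose, and $\oplus$ denotes the block-diagonal direct sum of matrices. The representation $D_\phi$, $\phi=(n-1,1)$: let $\tau_k=(k,k+1)$, $1\le k\le n-1$, be the adjacent transpositions. $D_\phi$ is the Young orthogonal representation for the partition $\phi=(n-1,1)$, i.e. the group homomorphism from $S_n$ to the real orthogonal $(n-1)\times(n-1)$ matrices determined by its values on the generators $\tau_k$: $D_\phi(\tau_1)=\mathrm{diag}[1,1,\ldots,1,-1]$, and for $k=2,\ldots,n-1$, $$D_\phi(\tau_k)=\mathcal{I}_{n-k-1}\oplus R_k\oplus \mathcal{I}_{k-2},\qquad R_k=\begin{pmatrix}-\frac1k&\sqrt{1-\frac1{k^2}}\\ \sqrt{1-\frac1{k^2}}&\frac1k\end{pmatrix}.$$ (These matrices satisfy the Coxeter relations, so the homomorphism exists; the representation is irreducible.) Also $D_{(n)}(\sigma)=1$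 for all $\sigma\in S_n$. The Fourier transform $\mathcal{F}$: for a complex vector $x=(x(1),\ldots,x(n))^t$, define $\widetilde{x}:S_n\to\mathbb{C}$ by $\widetilde{x}(\sigma)=x(\sigma(n))$ and, for $\nu\in\{(n),\phi\}$, $\widetilde{X}(\nu)=\sum_{\sigma\in S_n}\widetilde{x}(\sigma)D_\nu(\sigma)$. $\mathcal{F}$ is the $n\times n$ matrix of the linear map $\mathbb{C}^n\to\mathbb{C}^n$ sending $x$ to the column vector $$\mathcal{F}x=\left(\widetilde{X}((n)),\ \widetilde{X}(\phi)_{1,1},\ \widetilde{X}(\phi)_{2,1},\ \ldots,\ \widetilde{X}(\phi)_{n-1,1}\right)^t .$$ The matrix $\mathcal{T}$: let $U$ be the $n\times n$ matrix whose first row consists entirely of $1$'s, and whose $m$-th row, for $2\le m\le n$, has entries $-1$ in columns $1,\ldots,n-m+1$, entry $n-m+1$ in column $n-m+2$, and $0$ in all later columns (so row $2$ is $(-1,\ldots,-1,n-1)$ and row $n$ is $(-1,1,0,\ldots,0)$). Let $A=(UU^t)^{-1/2}$, which is the diagonal matrix with $A_{1,1}=1/\sqrt n$ and $A_{k,k}=1/\sqrt{(n-k+1)(n-k+2)}$ for $k>1$. Set $\mathcal{T}=AU$. *)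

(* Defs.v *)
From HB Require Import structures.
From mathcomp Require Import all_boot all_order all_fingroup all_algebra.
From mathcomp Require Import complex reals ring lra zify.

Set Implicit Arguments.
Unset Strict Implicit.
Unset Printing Implicit Defensive.

Import Order.TTheory GRing.Theory Num.Theory.
Local Open Scope ring_scope.

(* The real field is an arbitrary R : realType and the complex field is R[i].
   Throughout, n = m.+2 (so n >= 2 and n - 1 = m.+1), and I_n = {1, ..., n} is
   'I_m.+2 shifted by one: the point n is ord_max. *)

(* Composition of permutations, (s o t)(i) = s (t i); the product of the
   library's group 'S_n composes in the opposite order. *)
Definition perm_comp (n : nat) (s t : 'S_n) : 'S_n := (t * s)%g.

Lemma perm_compE (n : nat) (s t : 'S_n) i : perm_comp s t i = s (t i).
Proof. by rewrite permM. Qed.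

Definition mxdsum (T : pzRingType) (p q : nat) (A : 'M[T]_p) (B : 'M[T]_q) :
  'M[T]_(p + q) := block_mx A 0 0 B.

(* (k, k+1) for 1 <= k <= n - 1. *)
Definition adj_transp (m k : nat) : 'S_m.+2 := tperm (inord k.-1) (inord k).

Definition young_R (R : realType) (k : nat) : 'M[R]_2 :=
  \matrix_(i, j) if i == j then (if i == ord0 then - k%:R^-1 else k%:R^-1)
                 else Num.sqrt (1 - (k%:R ^+ 2)^-1).

Definition young_gen1 (R : realType) (m : nat) : 'M[R]_m.+1 :=
  diag_mx (\row_j if j == ord_max then -1 else 1).

(* For 2 <= k <= n - 1 the size (n - k - 1) + (2 + (k - 2)) of the direct sum
   equals n - 1, and conform_mx only transports it to 'M_(n - 1); its first
   argument is a default value for the other values of k. *)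
Definition young_gen (R : realType) (m k : nat) : 'M[R]_m.+1 :=
  conform_mx 0
    (mxdsum (1%:M : 'M[R]_(m.+1 - k))
            (mxdsum (young_R R k) (1%:M : 'M[R]_(k - 2)))).

Record is_young_orthogonal (R : realType) (m : nat)
    (D : 'S_m.+2 -> 'M[R]_m.+1) : Prop := IsYoungOrthogonal {
  young_morph : forall s t, D (perm_comp s t) = D s *m D t;
  young_orth : forall s, D s *m (D s)^T = 1%:M;
  young_transp1 : D (adj_transp m 1) = young_gen1 R m;
  young_transp : forall k, (2 <= k <= m.+1)%N ->
    D (adj_transp m k) = young_gen R m k
}.

Definition trivial_rep (R : realType) (n : nat) (s : 'S_n) : 'M[R]_1 := 1%:M.

Definition lift_fun (R : realType) (m : nat) (x : 'cV[R[i]]_m.+2)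
  (s : 'S_m.+2) : R[i] := x (s ord_max) 0.

Definition fourier_coef (R : realType) (m d : nat) (D : 'S_m.+2 -> 'M[R]_d)
    (x : 'cV[R[i]]_m.+2) : 'M[R[i]]_d :=
  \sum_(s : 'S_m.+2) lift_fun x s *: map_mx (real_complex R) (D s).

Definition fourier (R : realType) (m : nat) (D : 'S_m.+2 -> 'M[R]_m.+1)
    (x : 'cV[R[i]]_m.+2) : 'cV[R[i]]_(1 + m.+1) :=
  col_mx (fourier_coef (@trivial_rep R m.+2) x) (col ord0 (fourier_coef D x)).

Definition fourier_mx (R : realType) (m : nat) (D : 'S_m.+2 -> 'M[R]_m.+1) :
    'M[R[i]]_m.+2 :=
  \matrix_(i, j) fourier D (delta_mx j 0) i 0.

(* Row 0 is constant; with 1-based row index i.+1 the pivot n - (i.+1) + 1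
   is n - i, sitting in the 0-based column n - i. *)
Definition Umx (R : realType) (m : nat) : 'M[R]_m.+2 :=
  \matrix_(i, j) if i == ord0 then 1
                 else if (j < m.+2 - i)%N then -1
                 else if (j == m.+2 - i :> nat)%N then (m.+2 - i)%:R else 0.

Definition Amx (R : realType) (m : nat) : 'M[R]_m.+2 :=
  diag_mx (\row_i if i == ord0 then (Num.sqrt m.+2%:R)^-1
                  else (Num.sqrt ((m.+2 - i)%:R * (m.+2 - i).+1%:R))^-1).

Definition Tmx (R : realType) (m : nat) : 'M[R]_m.+2 := Amx R m *m Umx R m.

Lemma fourier_mxE (R : realType) (m : nat) (D : 'S_m.+2 -> 'M[R]_m.+1)
  (x : 'cV[R[i]]_m.+2) : fourier_mx D *m x = fourier D x.
Proof.
have coefE d (E : 'S_m.+2 -> 'M[R]_d) : fourier_coef E x =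
    \sum_j x j 0 *: fourier_coef E (delta_mx j 0).
  rewrite /fourier_coef; under [RHS]eq_bigr do rewrite scaler_sumr.
  rewrite exchange_big; apply: eq_bigr => s _ /=.
  rewrite (bigD1 (s ord_max)) //= /lift_fun big1 => [|j /negPf sj].
    by rewrite mxE !eqxx scale1r addr0.
  by rewrite mxE [s _ == _]eq_sym sj scale0r scaler0.
apply/matrixP => i k; rewrite ord1 !mxE.
under eq_bigr do rewrite !mxE.
case: (@split 1 m.+1 i) => a; rewrite ?[col _ _ _ _]mxE coefE summxE; apply: eq_bigr => j _;
  by rewrite !mxE mulrC.
Qed.

(* Row i > 0 of the matrix U, as a function of c = n - i and of the column. *)
Definition Urow (R : realType) (c j : nat) : R :=
  if (j < c)%N then -1 else if j == c then c%:R else 0.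

Lemma Urow_sum (R : realType) (n c : nat) (f : nat -> R) : (c < n)%N ->
  \sum_(j < n) Urow R c j * f j = c%:R * f c - \sum_(j < c) f j.
Proof.
move=> cn; rewrite -(big_mkord xpredT (fun j => Urow R c j * f j)).
rewrite (big_cat_nat (n := c)) ?(ltnW cn)//= big_mkord.
rewrite big_ltn //= [X in _ + (_ + X)]big_nat [X in _ + (_ + X)]big1 => [|j /andP[cj _]]; last first.
  by rewrite /Urow ltnNge (ltnW cj) gtn_eqF ?mul0r.
rewrite addr0 addrC /Urow ltnn eqxx; congr (_ + _); rewrite -sumrN.
by apply: eq_bigr => j _; rewrite ltn_ord mulN1r.
Qed.

Lemma UmxE (R : realType) (m : nat) (i j : 'I_m.+2) :
  Umx R m i j = if i == ord0 then 1 else Urow R (m.+2 - i) j.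
Proof. by rewrite mxE. Qed.

Lemma Umx_gram (R : realType) (m : nat) : Umx R m *m (Umx R m)^T =
  diag_mx (\row_i if i == ord0 then m.+2%:R
                  else (m.+2 - i)%:R * (m.+2 - i).+1%:R).
Proof.
have sum0 (i : 'I_m.+2) : i != ord0 -> \sum_j Umx R m i j = 0.
  move=> i0; under eq_bigr do rewrite UmxE (negPf i0) -[Urow _ _ _]mulr1.
  rewrite (Urow_sum (fun=> 1)) ?mulr1 ?sumr_const ?card_ord ?subrr//.
  by move: i0; rewrite -val_eqE /= => i0; lia.
have ltP (i k : 'I_m.+2) : k != ord0 -> (k < i)%N ->
    \sum_j Umx R m i j * Umx R m k j = 0.
  move=> k0 ki; have i0 : i != ord0 by rewrite -val_eqE /=; lia.
  under eq_bigr do rewrite !UmxE (negPf i0) (negPf k0).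
  have kn : (m.+2 - i < m.+2 - k)%N by have := ltn_ord i; lia.
  rewrite Urow_sum; last by have := ltn_ord i; lia.
  rewrite {1}/Urow kn (eq_bigr (fun=> -1)) => [|j _].
    by rewrite sumr_const card_ord mulrN1 mulNrn addrN.
  by rewrite /Urow (ltn_trans (ltn_ord j) kn).
apply/matrixP => i k; rewrite !mxE; under eq_bigr do rewrite [_^T _ _]mxE.
have [<-{k}|ik] := eqVneq i k; rewrite ?mulr1n ?mulr0n.
  have [->|i0] := eqVneq i ord0.
    by under eq_bigr do rewrite UmxE eqxx mulr1; rewrite sumr_const card_ord.
  under eq_bigr do rewrite UmxE (negPf i0); rewrite Urow_sum; last first.
    by move: i0; rewrite -val_eqE /= => i0; lia.
  rewrite {1}/Urow ltnn eqxx (eq_bigr (fun=> -1)) => [|j _].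
    by rewrite sumr_const card_ord; rewrite -[in RHS]natr1; ring.
  by rewrite /Urow ltn_ord.
have [i0|i0] := eqVneq i ord0.
  under eq_bigr do rewrite UmxE i0 eqxx mul1r; rewrite sum0 //.
  by rewrite -i0 eq_sym.
have [k0|k0] := eqVneq k ord0.
  by under eq_bigr do rewrite [X in _ * X]UmxE k0 eqxx mulr1; rewrite sum0.
case: (ltngtP i k) => [lt|lt|/val_inj e]; last by rewrite e eqxx in ik.
  by under eq_bigr do rewrite mulrC; rewrite ltP.
by rewrite ltP.
Qed.

(* A is the nonnegative diagonal matrix (U U^t)^(-1/2). *)
Lemma Amx_gram (R : realType) (m : nat) :
  Amx R m *m Amx R m *m (Umx R m *m (Umx R m)^T) = 1%:M.
Proof.
rewrite Umx_gram !mulmx_diag -diag_const_mx; congr diag_mx.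
apply/rowP => i; rewrite !mxE; case: ifP => [_|/negbT i0].
  by rewrite -expr2 exprVn sqr_sqrtr ?ler0n// mulVf// pnatr_eq0.
rewrite -expr2 exprVn sqr_sqrtr -?natrM ?ler0n// mulVf// pnatr_eq0.
by have := ltn_ord i; rewrite -lt0n muln_gt0 subn_gt0 => ->.
Qed.

Lemma Tmx_orth (R : realType) (m : nat) : Tmx R m *m (Tmx R m)^T = 1%:M.
Proof.
have := Amx_gram R m; rewrite Umx_gram -mulmxA {2}/Amx diag_mxC => <-.
rewrite /Tmx trmx_mul -mulmxA [Umx R m *m _]mulmxA Umx_gram.
by rewrite {2}/Amx tr_diag_mx.
Qed.

Definition young_norm (R : realType) (c : nat) : R :=
  (Num.sqrt (c%:R * c.+1%:R))^-1.

Definition Tlow (R : realType) (m : nat) : 'M[R]_(m.+1, m.+2) :=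
  row' ord0 (Tmx R m).

Lemma TlowE (R : realType) (m : nat) i j : Tlow R m i j =
  young_norm R (m.+1 - i) * Urow R (m.+1 - i) j.
Proof. by rewrite mxE /Tmx mul_diag_mx !mxE /= !subSS. Qed.

Lemma Tlow_orth (R : realType) (m : nat) : Tlow R m *m (Tlow R m)^T = 1%:M.
Proof.
apply/matrixP => i j; have /matrixP/(_ (lift ord0 i) (lift ord0 j)) := Tmx_orth R m.
rewrite !mxE (inj_eq lift_inj) => <-.
by apply: eq_bigr => k _; rewrite !mxE.
Qed.

Lemma young_norm12 (R : realType) (q : nat)
    (s := Num.sqrt (1 - (q.+2%:R ^+ 2)^-1) : R) :
  s * young_norm R q.+1 = q.+3%:R / q.+2%:R * young_norm R q.+2 /\
  s * young_norm R q.+2 = q.+1%:R / q.+2%:R * young_norm R q.+1.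
Proof.
have sq_gt0 (l : nat) : 0 < Num.sqrt l.+1%:R :> R by rewrite sqrtr_gt0 ltr0n.
have sqE (l : nat) : Num.sqrt l.+1%:R ^+ 2 = l.+1%:R :> R.
  by rewrite sqr_sqrtr ?ler0n.
have sE : s = Num.sqrt q.+1%:R * Num.sqrt q.+3%:R / q.+2%:R.
  rewrite -[RHS]ger0_norm ?divr_ge0 ?mulr_ge0 ?sqrtr_ge0 // -sqrtr_sqr.
  rewrite /s; congr Num.sqrt; rewrite !exprMn !sqE exprVn -!natr1.
  have := ler0n R q; move: (q%:R) => t t0.
  by field; lra.
rewrite sE /young_norm !sqrtrM ?ler0n //.
move: (sqE q) (sqE q.+1) (sqE q.+2) (lt0r_neq0 (sq_gt0 q)).
move: (lt0r_neq0 (sq_gt0 q.+1)) (lt0r_neq0 (sq_gt0 q.+2)).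
move: (Num.sqrt q.+1%:R) (Num.sqrt q.+2%:R) (Num.sqrt q.+3%:R) => a b c.
by move=> b0 c0 <- <- <- a0; split; field; rewrite a0 b0 ?c0.
Qed.

Lemma young_norm1 (R : realType) (q : nat) :
  Num.sqrt (1 - (q.+2%:R ^+ 2)^-1) * young_norm R q.+1 =
  q.+3%:R / q.+2%:R * young_norm R q.+2.
Proof. by case: (young_norm12 R q). Qed.

Lemma young_norm2 (R : realType) (q : nat) :
  Num.sqrt (1 - (q.+2%:R ^+ 2)^-1) * young_norm R q.+2 =
  q.+1%:R / q.+2%:R * young_norm R q.+1.
Proof. by case: (young_norm12 R q). Qed.

Lemma Urow_swap (R : realType) (q j : nat)
    (tj := if j == q then q.+1 else if j == q.+1 then q else j) :
  q.+1%:R * Urow R q.+1 tj = - Urow R q.+1 j + q.+2%:R * Urow R q j /\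
  q.+1%:R * Urow R q tj = q%:R * Urow R q.+1 j + Urow R q j.
Proof.
rewrite /tj /Urow -!natr1.
have [jq|jq] := eqVneq j q.
  have -> : (q.+1 < q.+1)%N = false by lia.
  have -> : (q.+1 < q)%N = false by lia.
  have -> : (q.+1 == q) = false by lia.
  have -> : (j < q)%N = false by lia.
  have -> : (j < q.+1)%N by lia.
  by rewrite eqxx; split; ring.
have [jq1|jq1] := eqVneq j q.+1.
  have -> : (q < q.+1)%N by lia.
  have -> : (q < q)%N = false by lia.
  have -> : (j < q)%N = false by lia.
  have -> : (j < q.+1)%N = false by lia.
  by rewrite eqxx; split; ring.
rewrite (negPf jq) (negPf jq1); have -> : (j < q.+1)%N = (j < q)%N by lia.
by case: ifP => _; split; ring.
Qed.

Lemma mid_sum (R : pzRingType) (a b n : nat) (M : 'M[R]_2) (V : nat -> R)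
    (i : 'I_n) : (a + (2 + b))%N = n ->
  \sum_l conform_mx (0 : 'M[R]_n) (mxdsum (1%:M : 'M_a) (mxdsum M (1%:M : 'M_b))) i l * V l =
    if i == a :> nat then M 0 0 * V a + M 0 1 * V a.+1
    else if i == a.+1 :> nat then M 1 0 * V a + M 1 1 * V a.+1
    else V i.
Proof.
move=> e; case: n / e i => i; rewrite conform_mx_id big_split_ord /=.
rewrite big_split_ord /= !big_ord_recl big_ord0 /= !addn0 addr0.
have dl (p : nat) (k : 'I_p) (W : 'I_p -> R) :
    \sum_l (1%:M : 'M_p) k l * W l = W k.
  rewrite (bigD1 k) //= big1 => [|l /negPf lk].
    by rewrite mxE eqxx mul1r addr0.
  by rewrite mxE eq_sym lk mul0r.
rewrite /mxdsum.
case: (splitP i) => [k ik|k ik].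
  have -> : i = lshift _ k by apply/val_inj.
  under eq_bigr do rewrite block_mxEul.
  rewrite dl !block_mxEur !mxE !mul0r !add0r big1 ?addr0 => [|l _]; last first.
    by rewrite block_mxEur mxE mul0r.
  by rewrite /= !ltn_eqF // ltnW // ltnS.
have -> : i = rshift _ k by apply/val_inj.
rewrite big1 ?add0r => [|l _]; last by rewrite block_mxEdl mxE mul0r.
rewrite !block_mxEdr; under eq_bigr do rewrite block_mxEdr.
case: (splitP k) => [l kl|l kl].
  have -> : k = lshift _ l by apply/val_inj.
  rewrite !block_mxEul [X in _ + X]big1 ?addr0 => [|q _]; last first.
    by rewrite block_mxEur mxE mul0r.
  rewrite /bump /= addn1.
  have -> : lift ord0 ord0 = 1 :> 'I_2 by apply/val_inj.
  case: l {kl} => [[|[|//]] l2] /=.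
    by rewrite addn0 eqxx; congr (M _ _ * _ + M _ _ * _); apply/val_inj.
  rewrite addn1 eqxx gtn_eqF //.
  by congr (M _ _ * _ + M _ _ * _); apply/val_inj.
have -> : k = rshift _ l by apply/val_inj.
rewrite !block_mxEdl !mxE !mul0r !add0r.
under eq_bigr do rewrite block_mxEdr.
rewrite (dl _ _ (fun q : 'I_b => V (a + (2 + q))%N)) /=.
by rewrite !gtn_eqF //; lia.
Qed.

(* D s is the matrix, in the orthonormal basis given by the rows of T other than
   the first, of the action of s on the vectors of sum 0. *)
Lemma young_orthogonal_ex (R : realType) (m : nat) :
  exists D : 'S_m.+2 -> 'M[R]_m.+1, is_young_orthogonal D.
Proof.
pose T := Tlow R m; pose r := row ord0 (Tmx R m).
have rE i j : r i j = (Num.sqrt m.+2%:R)^-1.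
  by rewrite mxE /Tmx mul_diag_mx !mxE /= mulr1.
have TTr : T^T *m T = 1%:M - r^T *m r.
  rewrite -(mulmx1C (Tmx_orth R m)); apply/matrixP => i j.
  rewrite !mxE big_ord1 [X in _ = X - _]big_ord_recl !mxE [X in _ = X - _]addrC addrK.
  by apply: eq_bigr => k _; rewrite !mxE.
have Tr : T *m r^T = 0.
  apply/matrixP => i j; have /matrixP/(_ (lift ord0 i) ord0) := Tmx_orth R m.
  rewrite !mxE => E; rewrite -[RHS]E.
  by apply: eq_bigr => k _; rewrite !mxE.
have permr (s : 'S_m.+2) : perm_mx s *m r^T = r^T.
  by rewrite -row_permE; apply/matrixP => i j; rewrite mxE [LHS]mxE [RHS]mxE !rE.
pose D (s : 'S_m.+2) : 'M[R]_m.+1 := T *m perm_mx s^-1 *m T^T.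
have DM s t : D (perm_comp s t) = D s *m D t.
  rewrite /D /perm_comp invMg perm_mxM -!mulmxA; congr (_ *m _).
  rewrite [T^T *m (T *m _)]mulmxA TTr mulmxBl mul1mx mulmxBr -!mulmxA.
  rewrite [perm_mx s^-1 *m (r^T *m _)]mulmxA permr.
  suff -> : r *m (perm_mx t^-1 *m T^T) = 0 by rewrite mulmx0 subr0.
  apply: (can_inj (@trmxK _ _ _)); rewrite !trmx_mul trmxK trmx0.
  by rewrite tr_perm_mx invgK -mulmxA permr Tr.
have DG (k : nat) (G : 'M[R]_m.+1) :
    (forall i j, T i (adj_transp m k j) = \sum_l G i l * T l j) ->
    D (adj_transp m k) = G.
  move=> TG; rewrite /D -col_permE.
  suff -> : col_perm (adj_transp m k) T = G *m T.
    by rewrite -mulmxA Tlow_orth mulmx1.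
  by apply/matrixP => i j; rewrite !mxE -TG /T !mxE.
have adjE k (j : 'I_m.+2) : (0 < k <= m.+1)%N -> adj_transp m k j =
    (if j == k.-1 :> nat then k else if j == k :> nat then k.-1 else j) :> nat.
  move=> k0; rewrite /adj_transp.
  have kE : (inord k : 'I_m.+2) = k :> nat by rewrite inordK//; lia.
  have k1E : (inord k.-1 : 'I_m.+2) = k.-1 :> nat by rewrite inordK//; lia.
  case: tpermP => [->|->|]; rewrite ?kE ?k1E ?eqxx//.
    by case: eqP => //; lia.
  by move=> /eqP + /eqP; rewrite -!val_eqE /= kE k1E => /negPf-> /negPf->.
exists D; split => //.
- move=> s; suff -> : (D s)^T = D s^-1%g.
    by rewrite -DM /D /perm_comp mulVg invg1 perm_mx1 mulmx1 Tlow_orth.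
  by rewrite /D !trmx_mul trmxK tr_perm_mx mulmxA.
- apply: DG => i j; rewrite (bigD1 i) //= big1 ?addr0 => [|l /negPf li]; last first.
    by rewrite !mxE [i == l]eq_sym li mulr0n mul0r.
  rewrite [young_gen1 R m i i]mxE [(\row__ _) _ _]mxE eqxx mulr1n.
  rewrite /T !TlowE adjE //=.
  have := ltn_ord i; have [-> _|im im1] := eqVneq i ord_max.
    rewrite /= subSnn mulN1r -mulrN; congr (_ * _); rewrite /Urow.
    by case: (nat_of_ord j) => [|[|]] //=; rewrite ?opprK ?oppr0.
  have {}im : (i < m)%N by move: im; rewrite -val_eqE /=; lia.
  rewrite mul1r; congr (_ * _); rewrite /Urow.
  have : (1 < m.+1 - i)%N by lia.
  by case: (m.+1 - i)%N => [|[|c]] // _; case: (nat_of_ord j) => [|[|]].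
- move=> k /andP[k2 km]; apply: DG => i j.
  have kn0 : k%:R != 0 :> R by rewrite pnatr_eq0; lia.
  pose V l := young_norm R (m.+1 - l) * Urow R (m.+1 - l) j.
  under eq_bigr do rewrite TlowE -/(V _).
  rewrite mid_sum; last by lia.
  rewrite /T TlowE adjE; last by lia.
  rewrite !mxE /= /V; set tj := (X in Urow _ _ X).
  have [ip|ip] := eqVneq (nat_of_ord i) (m.+1 - k)%N.
    have -> : (m.+1 - (m.+1 - k).+1 = k.-1)%N by lia.
    have ik : (m.+1 - i = k)%N by lia.
    have -> : (m.+1 - (m.+1 - k) = k)%N by lia.
    rewrite ik; case: k k2 {km ip ik V} kn0 @tj => [|[|q]] // _ kn0 tj.
    rewrite /= [Num.sqrt _ * _]mulrA young_norm1 /tj /=.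
    have [E _] := Urow_swap R q.+1 j; apply: (mulfI kn0).
    by rewrite mulrCA {}E; field; rewrite -natrD.
  have [iq|iq] := eqVneq (nat_of_ord i) (m.+1 - k).+1.
    have -> : (m.+1 - (m.+1 - k).+1 = k.-1)%N by lia.
    have -> : (m.+1 - i = k.-1)%N by lia.
    have -> : (m.+1 - (m.+1 - k) = k)%N by lia.
    case: k k2 {km ip iq V} kn0 @tj => [|[|q]] // _ kn0 tj.
    rewrite /= [Num.sqrt _ * _]mulrA young_norm2 /tj /=.
    have [_ E] := Urow_swap R q.+1 j; apply: (mulfI kn0).
    by rewrite mulrCA {}E; field; rewrite -natrD.
  congr (_ * _).
  have ik : (m.+1 - i != k)%N by have := ltn_ord i; lia.
  have iq' : (m.+1 - i != k.-1)%N by have := ltn_ord i; lia.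
  move: (m.+1 - i)%N ik iq' => c ck cq; rewrite /tj /Urow.
  case: (eqVneq (nat_of_ord j) k.-1) => [->|_].
    rewrite [k == c]eq_sym [k.-1 == c]eq_sym (negPf ck) (negPf cq).
    by have -> : (k < c)%N = (k.-1 < c)%N by lia.
  case: (eqVneq (nat_of_ord j) k) => [->|//].
  rewrite [k == c]eq_sym [k.-1 == c]eq_sym (negPf ck) (negPf cq).
  by have -> : (k < c)%N = (k.-1 < c)%N by lia.
Qed.

(* Main.v *)
Require Import Defs.
From HB Require Import structures.
From mathcomp Require Import all_boot all_order all_fingroup all_algebra.
From mathcomp Require Import complex reals.
From mathcomp Require Import ring zify.

Set Implicit Arguments.
Unset Strict Implicit.
Unset Printing Implicit Defensive.
Import GRing.Theory Num.Theory.
Local Open Scope ring_scope.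

(** Each [D tau_k] acts on the columns of the lower n - 1 rows [Tlow] of the
    matrix T by the transposition [tau_k]; as the [tau_k] generate the symmetric
    group, [D s *m Tlow] permutes the columns of [Tlow] by [s], for all [s].
    Since the rows of [Tlow] are orthonormal, sum to 0, and the first one is a
    combination of (0, ..., 0, 1) and (1, ..., 1), the first column of [D s] is
    a fixed multiple of column [s n] of [Tlow].  Summing over the permutations
    sending n to j, whose number does not depend on j, gives column j of the
    Fourier matrix. *)

Lemma adj_transpE (m k : nat) (j : 'I_m.+2) : (0 < k <= m.+1)%N ->
  adj_transp m k j =
    (if j == k.-1 :> nat then k else if j == k :> nat then k.-1 else j) :> nat.
Proof.
move=> k0; rewrite /adj_transp.
have kE : (inord k : 'I_m.+2) = k :> nat by rewrite inordK//; lia.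
have k1E : (inord k.-1 : 'I_m.+2) = k.-1 :> nat by rewrite inordK//; lia.
case: tpermP => [->|->|/eqP + /eqP]; rewrite ?kE ?k1E ?eqxx //.
  by case: eqP => //; lia.
by rewrite -!val_eqE /= kE k1E => /negPf-> /negPf->.
Qed.

(** Every permutation is a product of transpositions, and each of these comes from adjacent ones by
    conjugation, by induction on the distance between the two points. *)
Lemma adj_transp_ind (m : nat) (P : 'S_m.+2 -> Prop) :
    (forall k, (0 < k <= m.+1)%N -> P (adj_transp m k)) ->
    (forall s t, P s -> P t -> P (s * t)%g) ->
  forall s, P s.
Proof.
move=> Padj PM; have P1 : P 1%g.
  by rewrite -(tperm2 (inord 0) (inord 1)); apply: PM; apply: (Padj 1).
have Plt d (x y : 'I_m.+2) : y = (x + d).+1 :> nat -> P (tperm x y).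
  elim: d y => [|d IHd] y yE; have ym := ltn_ord y.
    rewrite (_ : tperm x y = adj_transp m y); first by apply: Padj; lia.
    by congr tperm; apply/val_inj; rewrite /= inordK //; lia.
  have yz : (inord y.-1 : 'I_m.+2) = y.-1 :> nat by rewrite inordK //; lia.
  have -> : tperm x y = (tperm x (inord y.-1) ^ tperm (inord y.-1) y)%g.
    rewrite tpermJ tpermL tpermD // -val_eqE /= ?yz; lia.
  have Py : P (tperm (inord y.-1) y).
    by have := Padj y; rewrite /adj_transp inord_val; apply; lia.
  by rewrite conjgE tpermV; do 2!apply: (PM) => //; apply: IHd; lia.
move=> s; have [ts -> _] := prod_tpermP s.
apply: (big_ind P) => // -[x y] _ /=.
case: (ltngtP x y) => [xy|yx|/val_inj->]; last by rewrite tperm1.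
  by apply: (Plt (y - x.+1)%N); lia.
by rewrite tpermC; apply: (Plt (x - y.+1)%N); lia.
Qed.

(** An entry of [Urow R c] depends only on whether its column is below, at or above [c], and [k.-1]
    and [k] lie strictly on the same side of [c]. *)
Lemma Urow_swap_id (R : realType) (c k j : nat)
    (tj := if j == k.-1 then k else if j == k then k.-1 else j) :
  (0 < k)%N -> c != k.-1 -> c != k -> Urow R c tj = Urow R c j.
Proof.
move=> k0 ck1 ck; rewrite {}/tj /Urow.
have klt : (k < c)%N = (k.-1 < c)%N by lia.
case: (eqVneq j k.-1) => [->|_]; last case: (eqVneq j k) => [->|//].
all: by rewrite klt ![_ == c]eq_sym (negPf ck) (negPf ck1).
Qed.

(** The last row is a multiple of (-1, 1, 0, ..., 0), which the swap negates; every other row has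
    equal entries in the first two columns. *)
Lemma young_gen1_Tlow (R : realType) (m : nat) :
  young_gen1 R m *m Tlow R m = col_perm (adj_transp m 1) (Tlow R m).
Proof.
apply/matrixP => i j; rewrite mul_diag_mx mxE [RHS]mxE mxE !TlowE adj_transpE //.
have := ltn_ord i; have [-> _|im im1] := eqVneq i ord_max.
  rewrite /= subSnn mulN1r -mulrN; congr (_ * _).
  by rewrite /Urow; case: (nat_of_ord j) => [|[|]] //=; rewrite ?opprK ?oppr0.
rewrite mul1r (@Urow_swap_id _ _ 1) //; move: im; rewrite -val_eqE /=; lia.
Qed.

Lemma young_gen_Tlow (R : realType) (m k : nat) : (2 <= k <= m.+1)%N ->
  young_gen R m k *m Tlow R m = col_perm (adj_transp m k) (Tlow R m).
Proof.
move=> /andP[k2 km]; apply/matrixP => i j; have im := ltn_ord i.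
rewrite mxE [RHS]mxE; under eq_bigr do rewrite TlowE.
rewrite (mid_sum _
  (fun l => young_norm R (m.+1 - l) * Urow R (m.+1 - l) j)); last by lia.
rewrite TlowE adj_transpE ?km ?(ltnW k2) // !mxE /=.
(* Row [i] has its pivot in column [m.+1 - i], so the block [young_R R k] mixes the rows with pivots
   [k] and [k.-1]. *)
have -> : (m.+1 - (m.+1 - k) = k)%N by lia.
have -> : (m.+1 - (m.+1 - k).+1 = k.-1)%N by lia.
have kn0 : k%:R != 0 :> R by rewrite pnatr_eq0; lia.
have [ip|ip] := eqVneq (nat_of_ord i) (m.+1 - k)%N.
  have -> : (m.+1 - i = k)%N by lia.
  case: k k2 kn0 {km ip} => [|[|q]] //= _ kn0.
  (* The square root turns the norm factor of the other row into a rational multiple of that of row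
     [i]; what remains is a linear relation between rows of U. *)
  have [E _] := Urow_swap R q.+1 j; rewrite [Num.sqrt _ * _]mulrA young_norm1.
  by apply: (mulfI kn0); rewrite [RHS]mulrCA {}E; field; rewrite -natrD.
have [iq|iq] := eqVneq (nat_of_ord i) (m.+1 - k).+1.
  have -> : (m.+1 - i = k.-1)%N by lia.
  case: k k2 kn0 {km ip iq} => [|[|q]] //= _ kn0.
  have [_ E] := Urow_swap R q.+1 j; rewrite [Num.sqrt _ * _]mulrA young_norm2.
  by apply: (mulfI kn0); rewrite [RHS]mulrCA {}E; field; rewrite -natrD.
by rewrite Urow_swap_id //; lia.
Qed.

Lemma young_orthogonal_Tlow (R : realType) (m : nat) (D : 'S_m.+2 -> 'M[R]_m.+1) :
  is_young_orthogonal D ->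
  forall s, D s *m Tlow R m = col_perm s (Tlow R m).
Proof.
move=> hD; apply: adj_transp_ind => [k /andP[k0 km]|s t IHs IHt].
  have [k2|k1] := ltnP 1 k.
    by rewrite (young_transp hD) ?k2 // young_gen_Tlow ?k2.
  have -> : k = 1 by lia.
  by rewrite (young_transp1 hD) young_gen1_Tlow.
(* The product [s * t] applies [s] first, so [D] sends it to [D t *m D s]. *)
rewrite (_ : (s * t)%g = perm_comp t s) // (young_morph hD) -mulmxA IHs.
by rewrite col_permE mulmxA IHt -col_permE /perm_comp col_permM.
Qed.

Lemma Tlow_row_sum (R : realType) (m : nat) i : \sum_j Tlow R m i j = 0.
Proof.
under eq_bigr do rewrite TlowE -[Urow _ _ _]mulr1.
rewrite -mulr_sumr (Urow_sum (fun=> 1)); last by rewrite ltnS leq_subr.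
by rewrite mulr1 sumr_const card_ord subrr mulr0.
Qed.

Lemma Tlow_row0 (R : realType) (m : nat) (j : 'I_m.+2) :
  Tlow R m ord0 j = young_norm R m.+1 * (m.+2%:R * (j == ord_max)%:R - 1).
Proof.
rewrite TlowE subn0 /Urow -val_eqE /=; congr (_ * _).
have := ltn_ord j; rewrite ltnS leq_eqVlt.
by case: ltngtP => // _ _; rewrite ?mulr0 ?sub0r // mulr1 -[m.+2%:R]natr1 addrK.
Qed.

Lemma Tmx_row0 (R : realType) (m : nat) (j : 'I_m.+2) :
  Tmx R m ord0 j = (Num.sqrt m.+2%:R)^-1.
Proof. by rewrite /Tmx mul_diag_mx !mxE eqxx mulr1. Qed.

(** The lift of a basis vector is the indicator function of a coset of the stabilizer of
    [ord_max]. *)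
Lemma fourier_coef_delta (R : realType) (m d : nat) (D : 'S_m.+2 -> 'M[R]_d) j :
  fourier_coef D (delta_mx j 0) =
    map_mx (real_complex R) (\sum_(s : 'S_m.+2 | s ord_max == j) D s).
Proof.
rewrite raddf_sum [RHS]big_mkcond; apply: eq_bigr => s _ /=.
by rewrite /lift_fun mxE andbT; case: eqP => _; rewrite ?scale1r ?scale0r.
Qed.

(** Following [s] by the transposition of [j] and [ord_max] matches the two sets. *)
Lemma card_perm_send (m : nat) (j : 'I_m.+2) :
  #|[pred s : 'S_m.+2 | s ord_max == j]| =
  #|[pred s : 'S_m.+2 | s ord_max == ord_max]|.
Proof.
rewrite -!sum1_card [RHS](reindex_inj (mulIg (tperm j ord_max))) /=.
apply: eq_bigl => s; rewrite !inE permM.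
by rewrite (canF_eq (tpermK j ord_max)) tpermR.
Qed.

Lemma young_orthogonal_col0 (R : realType) (m : nat) (D : 'S_m.+2 -> 'M[R]_m.+1) :
  is_young_orthogonal D ->
  forall s i, D s i ord0 = young_norm R m.+1 * m.+2%:R * Tlow R m i (s ord_max).
Proof.
move=> hD s i; rewrite -[D s]mulmx1 -(Tlow_orth R m) mulmxA.
rewrite (young_orthogonal_Tlow hD) mxE.
under eq_bigr => j _.
  rewrite [_^T _ _]mxE Tlow_row0 mulrCA mulrBr mulr1 mulrCA mulrA mxE.
  over.
(* The constant part of row 0 of [Tlow] pairs to 0 with the permuted row [i], so only the term at
   [ord_max] survives. *)
have sum0 : \sum_j Tlow R m i (s j) = 0.
  by rewrite -[RHS](Tlow_row_sum R i) [RHS](reindex_inj (@perm_inj _ s)).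
rewrite -mulr_sumr sumrB sum0 subr0 (bigD1 ord_max) //= big1 => [|j /negPf->].
  by rewrite eqxx mulr1 addr0 mulrA.
by rewrite mulr0.
Qed.

Theorem mainTheorem2 (R : realType) (m : nat) (D : 'S_m.+2 -> 'M[R]_m.+1)
    (hD : is_young_orthogonal D) :
  exists lambda1 lambda2 : R[i],
    fourier_mx D =
      mxdsum (lambda1%:M : 'M[R[i]]_1) (lambda2%:M : 'M[R[i]]_m.+1)
        *m map_mx (real_complex R) (Tmx R m).
Proof.
pose N := #|[pred s : 'S_m.+2 | s ord_max == ord_max]|.
(* The factor sqrt n cancels the entries 1 / sqrt n of row 0 of T; the second scalar is [N] times
   the multiple in [young_orthogonal_col0], that is N sqrt(n / (n - 1)). *)
exists (real_complex R (N%:R * Num.sqrt m.+2%:R)).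
exists (real_complex R (N%:R * (young_norm R m.+1 * m.+2%:R))).
rewrite /mxdsum -!diag_const_mx -diag_mx_row; apply/matrixP => i j.
have sumN (c : R) : \sum_(s : 'S_m.+2 | s ord_max == j) c = c *+ N.
  by rewrite sumr_const card_perm_send.
move TE: (Tmx R m) => T; rewrite mul_diag_mx !mxE !fourier_coef_delta.
case: (@splitP 1 m.+1 i) => k ik; rewrite !mxE -rmorphM; congr (real_complex R _).
  have -> : i = ord0 by apply/val_inj; rewrite /= ik ord1.
  rewrite -TE Tmx_row0 mulfK ?lt0r_neq0 ?sqrtr_gt0 ?ltr0n // summxE.
  by rewrite -sumN; apply: eq_bigr => s _; rewrite mxE ord1 eqxx.
have -> : i = lift ord0 k by apply/val_inj.
(* The first column of [D s] depends on [s] only through [s ord_max], so all [N] summands are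
   equal. *)
rewrite summxE; under eq_bigr => s /eqP sj do
  rewrite (young_orthogonal_col0 hD) sj mxE TE.
by rewrite sumN -[RHS]mulrA mulr_natl.
Qed.
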